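(* Let $q$ be a real number with $0<q<1$, and let $m$ and $n$ be non-negative integers. Then $$(-1)^m Z_n^{>}[\{1\}^m] = A_n^{>}[\{1\}^m].$$
   Context: For a non-negative integer $n$, $[n]_q := \sum_{k=0}^{n-1}q^k = \frac{1-q^n}{1-q}$. The Gaussian $q$-binomial coefficient is $\begin{bmatrix} n\\ k\end{bmatrix} := \prod_{j=1}^k \frac{1-q^{n-k+j}}{1-q^j}$ for $0\le k\le n$, and it is $0$ otherwise. The notation $\{1\}^{m}$ denotes $m\ge 0$ consecutive copies of the argument $1$ (the empty list if $m=0$). For non-negative integers $n,m,s_1,\dots,s_m$ define $$Z_n^{>}[s_1,\dots,s_m] := \sum_{n\ge k_1>\cdots> k_m\ge 1}\ \prod_{j=1}^m q^{k_j}[k_j]_q^{-s_j},$$ $$A_n^{>}[s_1,\dots,s_m] := \sum_{n\ge k_1>\cdots> k_m\ge 1} (-1)^{k_1}q^{k_1(k_1+1)/2}\begin{bmatrix} n\\ k_1\end{bmatrix}\prod_{j=1}^m q^{(s_j-1)k_j}[k_j]_q^{-s_j},$$ where the sums are over all integers $k_j$ satisfying the indicated inequalities, with the understanding that if $m>0$ then $Z_0^{>}[s_1,\dots,s_m]=A_0^{>}[s_1,\dots,s_m]=0$, and if $m=0$ then $Z_n^{>}[\;]=A_n^{>}[\;]=1$ for all $n\ge 0$. *)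

(* Defs.v *)
From mathcomp Require Import all_boot all_order all_algebra.
From mathcomp Require Import reals.

Set Implicit Arguments.
Unset Strict Implicit.
Unset Printing Implicit Defensive.

Import Order.TTheory GRing.Theory Num.Theory.
Local Open Scope ring_scope.

Definition qnum (R : realType) (q : R) (n : nat) : R := \sum_(k < n) q ^+ k.

Definition qbinom (R : realType) (q : R) (n k : nat) : R :=
  if (k <= n)%N
  then \prod_(1 <= j < k.+1) ((1 - q ^+ (n - k + j)%N) / (1 - q ^+ j))
  else 0.

(* n >= k_1 > ... > k_m >= 1; the upper bound n is carried by 'I_n.+1. The
   empty tuple qualifies, so for m = 0 there is exactly one summation index. *)
Definition strict_desc (n m : nat) (k : m.-tuple 'I_n.+1) : bool :=
  sorted gtn (map val k) && all (fun i : 'I_n.+1 => (0 < i)%N) k.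

(* The largest index k_1. For m = 0 the default 0 makes the prefactor of Agt
   equal to 1, in accordance with the convention that Agt is 1 on the empty
   list. *)
Definition first_idx (n m : nat) (k : m.-tuple 'I_n.+1) : nat :=
  head 0%N (map val k).

Definition Zgt (R : realType) (q : R) (n m : nat) (s : m.-tuple nat) : R :=
  \sum_(k : m.-tuple 'I_n.+1 | strict_desc k)
    \prod_(j < m) (q ^+ tnth k j * qnum q (tnth k j) ^- tnth s j).

(* The exponent (s_j - 1) k_j is an integer: it is negative when s_j = 0. *)
Definition Agt (R : realType) (q : R) (n m : nat) (s : m.-tuple nat) : R :=
  \sum_(k : m.-tuple 'I_n.+1 | strict_desc k)
    (let k1 := first_idx k in
     (-1) ^+ k1 * q ^+ (k1 * k1.+1)./2 * qbinom q n k1) *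
    \prod_(j < m) (q ^ (((tnth s j)%:Z - 1) * (tnth k j : nat)%:Z)
                   * qnum q (tnth k j) ^- tnth s j).

(* Main.v *)
Require Import Defs.
From mathcomp Require Import all_boot all_order all_algebra.
From mathcomp Require Import reals.
From mathcomp Require Import ring.

Import Order.TTheory GRing.Theory Num.Theory.
Local Open Scope ring_scope.

(** The identity holds because both sides obey the same recursion in [n].

    Put [w k = 1 / [k]_q] and let [e_r(N)] be the elementary symmetric
    polynomial of degree [r] in [w 1, ..., w N]. Splitting off the largest
    index turns the right-hand side, for [m = r + 1], into
      [A_n(r + 1) = \sum_(1 <= k <= n) c_n(k) w(k) e_r(k - 1)], where
      [c_n(k) = (-1)^k q^(k(k+1)/2) binom(n, k)_q],
    while the left-hand side is an elementary symmetric polynomial in the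
    numbers [q^k / [k]_q], so that
      [Z_(n+1)(r + 1) = Z_n(r + 1) + q^(n+1) / [n+1]_q * Z_n(r)].
    It remains to see that [A] satisfies
      [A_(n+1)(r + 1) - A_n(r + 1) = - q^(n+1) / [n+1]_q * A_n(r)].

    Two properties of the q-binomial coefficients give this.
    - [q^k (binom(n+1, k) - binom(n, k)) / [k]] equals
      [q^(n+1) binom(n+1, k) / [n+1]] ([qbinom_diff]), so the difference
      [A_(n+1)(r + 1) - A_n(r + 1)] is [q^(n+1) / [n+1]] times the sum over
      [1 <= k <= n + 1] of
      [(-1)^k q^(k(k-1)/2) binom(n+1, k) e_r(k - 1)].
    - By the q-Pascal rule the coefficient of [e_r(k - 1)] in that sum is the
      difference [c_n(k) - c_n(k - 1)] ([altcoef_diff]). Summation by parts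
      moves the difference onto [e_r], where
      [e_r(k) - e_r(k - 1) = w(k) e_(r-1)(k - 1)] for [r >= 1]; what comes out
      is [- A_n(r)] ([sum_altcoef_diff]).

    In the code [e_r(N)], [c_n(k)] and [A_n(m)] are [elemsym recip_qnum N r],
    [altcoef n k] and [altsum n m]; [Zgt_nseq1] and [Agt_nseq1] pass from sums
    over decreasing tuples to these recursive forms. *)

(** * Elementary symmetric sums over decreasing tuples *)

(** The elementary symmetric polynomial of degree [m] in [f 1, ..., f N]. The
    recursion is on the largest index, here [j.+1], because that index carries
    the additional weight in the sums under study. *)
Fixpoint elemsym {R : comPzRingType} (f : nat -> R) (N m : nat) : R :=
  if m is m'.+1 then \sum_(j < N) f j.+1 * elemsym f j m' else 1.

Lemma elemsymSS {R : comPzRingType} (f : nat -> R) N m :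
  elemsym f N.+1 m.+1 = elemsym f N m.+1 + f N.+1 * elemsym f N m.
Proof. by rewrite /= big_ord_recr. Qed.

Lemma elemsym0S {R : comPzRingType} (f : nat -> R) m : elemsym f 0 m.+1 = 0.
Proof. by rewrite /= big_ord0. Qed.

(** [strict_desc] with a movable bound on the largest entry, so that fixing the
    head of a tuple leaves a condition of the same form on its tail. *)
Definition desc {n : nat} (b : nat) {m : nat} (t : m.-tuple 'I_n.+1) : bool :=
  path gtn b.+1 (map val t) && all (fun i : 'I_n.+1 => (0 < i)%N) t.

Lemma strict_desc_desc {n m} (t : m.-tuple 'I_n.+1) : strict_desc t = desc n t.
Proof.
rewrite /strict_desc /desc; case: t => -[|i s] //= _.
by rewrite ltn_ord.
Qed.

Lemma desc_cons {n} b {m} (i : 'I_n.+1) (t : m.-tuple 'I_n.+1) :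
  desc b [tuple of i :: t] = ((0 < i <= b)%N && desc i.-1 t).
Proof.
rewrite /desc /= ltnS.
by case: (posnP i) => [->|i0]; rewrite ?andbF //= prednK // andbA.
Qed.

Lemma sum_tuple_cons {R : nmodType} {T : finType} {m} (P : pred (m.+1.-tuple T))
    (F : m.+1.-tuple T -> R) :
  \sum_(t | P t) F t =
  \sum_x \sum_(t : m.-tuple T | P [tuple of x :: t]) F [tuple of x :: t].
Proof.
rewrite pair_big_dep /=.
rewrite (reindex (fun p : T * m.-tuple T => [tuple of p.1 :: p.2])) //=.
exists (fun t => (thead t, [tuple of behead t])) => [[x t] _|t _].
  by congr pair; apply: val_inj.
by rewrite -tuple_eta.
Qed.

Lemma sum_ord_interval {R : nmodType} {n b} (F : nat -> R) : (b <= n)%N ->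
  \sum_(i < n.+1 | (0 < i <= b)%N) F i = \sum_(j < b) F j.+1.
Proof.
move=> bn; rewrite big_mkcond big_ord_recl /= add0r
  (big_ord_widen _ (fun j => F j.+1) bn).
by rewrite [RHS]big_mkcond.
Qed.

(** The weight [g] sits on the largest index only: with [g = 1] this is the
    recursive step towards [elemsym], with [g] an alternating q-binomial factor
    it evaluates [Agt]. *)
Lemma sum_desc_split {R : comPzRingType} (f g : nat -> R) {n b} m :
  (b <= n)%N ->
  \sum_(t : m.+1.-tuple 'I_n.+1 | desc b t)
     g (first_idx t) * \prod_(i <- t) f i =
  \sum_(j < b) g j.+1 * (f j.+1 *
     \sum_(t : m.-tuple 'I_n.+1 | desc j t) \prod_(i <- t) f i).
Proof.
move=> bn; pose F i := g i * (f i *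
     \sum_(t : m.-tuple 'I_n.+1 | desc i.-1 t) \prod_(i <- t) f i).
rewrite -(sum_ord_interval F bn) sum_tuple_cons [RHS]big_mkcond.
apply: eq_bigr => i _; under eq_bigl do rewrite desc_cons.
case: ifP => _; last by rewrite big_pred0_eq.
by rewrite /F !mulr_sumr; apply: eq_bigr => t _; rewrite big_cons.
Qed.

Lemma sum_desc {R : comPzRingType} (f : nat -> R) {n b} m : (b <= n)%N ->
  \sum_(t : m.-tuple 'I_n.+1 | desc b t) \prod_(i <- t) f i = elemsym f b m.
Proof.
elim: m b => [|m IH] b bn.
  rewrite (big_pred1 [tuple]) ?big_nil // => t.
  by rewrite (tuple0 t) /desc /= eqxx.
have := sum_desc_split f (fun=> 1) m bn; under eq_bigr do rewrite mul1r.
move=> ->; apply: eq_bigr => j _.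
by rewrite mul1r IH // ltnW // (leq_trans (ltn_ord j)).
Qed.

(** * Gaussian binomial coefficients *)

Section QBinomial.
Context {R : realType} {q : R}.
Hypotheses (hq0 : 0 < q) (hq1 : q < 1).

Let q_neq0 : q != 0. Proof. exact: lt0r_neq0. Qed.

Lemma subr1Xq_neq0 n : 1 - q ^+ n.+1 != 0.
Proof. by rewrite subr_eq0 eq_sym lt_eqF // exprn_ilt1 // ltW. Qed.

Lemma qnumE n : qnum q n = (1 - q ^+ n) / (1 - q).
Proof.
have q1 : 1 - q != 0 := subr1Xq_neq0 0.
by apply: (mulIf q1); rewrite divfK // mulrC -opprB mulNr -subrX1 opprB.
Qed.

Lemma qbinom0 n : qbinom q n 0 = 1.
Proof. by rewrite /qbinom big_geq. Qed.

Lemma qbinom_small n k : (n < k)%N -> qbinom q n k = 0.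
Proof. by rewrite /qbinom ltnNge => /negbTE ->. Qed.

(** The factors of the two products agree one by one, except for the last
    factor of the longer one. *)
Lemma qbinom_absorb n k :
  (1 - q ^+ k.+1) * qbinom q n.+1 k.+1 = (1 - q ^+ n.+1) * qbinom q n k.
Proof.
rewrite /qbinom ltnS; case: leqP => kn; last by rewrite !mulr0.
rewrite big_nat_recr //= subSS addnS subnK //.
by field; exact: subr1Xq_neq0.
Qed.

(** The powers of [q] are arranged so that the relation needs no bound on [k]:
    both sides vanish as soon as [k > n]. *)
Lemma qbinom_top n k :
  q ^+ k * (1 - q ^+ n.+1) * qbinom q n k
  = (q ^+ k - q ^+ n.+1) * qbinom q n.+1 k.
Proof.
elim: k n => [|k IH] n; first by rewrite !qbinom0 expr0 !mul1r.
apply: (mulfI (subr1Xq_neq0 k)).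
rewrite [RHS]mulrCA qbinom_absorb.
case: n => [|n].
  rewrite qbinom_small // !mulr0.
  by case: k {IH} => [|k]; rewrite ?subrr ?mul0r // qbinom_small // !mulr0.
rewrite mulrCA qbinom_absorb !exprS.
have := IH n; rewrite !exprS => IHn.
transitivity (q * (1 - q * (q * q ^+ n)) *
  (q ^+ k * (1 - q * q ^+ n) * qbinom q n k)); first by ring.
by rewrite IHn; ring.
Qed.

(** After multiplication by [1 - q ^+ n.+1], [qbinom_absorb] and [qbinom_top]
    express both terms on the right through [qbinom q n.+1 k.+1]. *)
Lemma qbinom_pascal n k :
  qbinom q n.+1 k.+1 = q ^+ k.+1 * qbinom q n k.+1 + qbinom q n k.
Proof.
apply: (mulfI (subr1Xq_neq0 n)).
rewrite mulrDr -qbinom_absorb mulrA [_ * q ^+ _]mulrC qbinom_top.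
by ring.
Qed.

(** The other q-Pascal rule, [q ^ (n - k) * qbinom q n k] for the difference,
    combined with absorption. In this form the factor on the right that
    depends on [n] alone is the new term in the recursion of [Zgt]. *)
Lemma qbinom_diff n k :
  q ^+ k.+1 * (qbinom q n.+1 k.+1 - qbinom q n k.+1) / qnum q k.+1
  = q ^+ n.+1 / qnum q n.+1 * qbinom q n.+1 k.+1.
Proof.
have Hk := subr1Xq_neq0 k; have Hn := subr1Xq_neq0 n.
have H1 : 1 - q != 0 := subr1Xq_neq0 0.
have key : (1 - q ^+ n.+1) *
    (q ^+ k.+1 * (qbinom q n.+1 k.+1 - qbinom q n k.+1)) =
    q ^+ n.+1 * (1 - q ^+ k.+1) * qbinom q n.+1 k.+1.
  rewrite mulrBr mulrBr [X in _ - X]mulrA [(1 - _) * q ^+ _]mulrC qbinom_top.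
  by ring.
have -> : q ^+ k.+1 * (qbinom q n.+1 k.+1 - qbinom q n k.+1) =
    q ^+ n.+1 * (1 - q ^+ k.+1) * qbinom q n.+1 k.+1 / (1 - q ^+ n.+1).
  by rewrite -key [RHS]mulrC mulKf.
by rewrite !qnumE; field; rewrite Hk Hn H1.
Qed.

(** * The alternating sums *)

Definition altcoef (n k : nat) : R :=
  (-1) ^+ k * q ^+ (k * k.+1)./2 * qbinom q n k.

Definition recip_qnum (k : nat) : R := (qnum q k)^-1.

Definition altsum (n m : nat) : R :=
  if m is r.+1 then
    \sum_(j < n) altcoef n j.+1 * (recip_qnum j.+1 * elemsym recip_qnum j r)
  else 1.

Lemma half_mulSS k : ((k.+1 * k.+2)./2 = (k * k.+1)./2 + k.+1)%N.
Proof.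
have -> : (k.+1 * k.+2 = k.+1.*2 + k * k.+1)%N.
  by rewrite -mul2n -mulnDl mulnC.
by rewrite halfD odd_double doubleK [RHS]addnC.
Qed.

Lemma altcoef_small n k : (n < k)%N -> altcoef n k = 0.
Proof. by move=> nk; rewrite /altcoef qbinom_small // mulr0. Qed.

(** The q-Pascal rule in telescoping form: its weight [q ^+ k.+1] is the ratio
    of the consecutive triangular powers of [q]. *)
Lemma altcoef_diff n k :
  altcoef n k.+1 - altcoef n k
  = (-1) ^+ k.+1 * q ^+ (k * k.+1)./2 * qbinom q n.+1 k.+1.
Proof. by rewrite /altcoef half_mulSS qbinom_pascal exprD exprS; ring. Qed.

(** Trades an increment in [n] for an increment in [k], to which summation by
    parts over [k] applies. *)
Lemma altcoef_step n k :
  (altcoef n.+1 k.+1 - altcoef n k.+1) * recip_qnum k.+1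
  = q ^+ n.+1 / qnum q n.+1 * (altcoef n k.+1 - altcoef n k).
Proof.
rewrite altcoef_diff [RHS]mulrCA -qbinom_diff /altcoef /recip_qnum.
by rewrite half_mulSS exprD; ring.
Qed.

(** Summation by parts. The upper boundary term vanishes since
    [altcoef n n.+1 = 0]. For [r = 0] the lower one, [- altcoef n 0 = - 1], is
    the whole result, because [elemsym] of degree [0] is constant; for [r > 0]
    it vanishes, and the increments of [elemsym] rebuild [altsum n r]. *)
Lemma sum_altcoef_diff n r :
  \sum_(j < n.+1) (altcoef n j.+1 - altcoef n j) * elemsym recip_qnum j r
  = - altsum n r.
Proof.
pose u := altcoef n; pose v j := elemsym recip_qnum j r.
have c0 : altcoef n 0 = 1 by rewrite /altcoef qbinom0 !expr0 !mulr1.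
have byparts : \sum_(j < n.+1) (u j.+1 - u j) * v j
    = u n.+1 * v n.+1 - u 0 * v 0 - \sum_(j < n.+1) u j.+1 * (v j.+1 - v j).
  rewrite -(telescope_sumr (fun j => u j * v j)) // big_mkord -sumrB.
  by apply: eq_bigr => j _; ring.
rewrite byparts /u /v altcoef_small // c0 mul0r sub0r mul1r.
rewrite big_ord_recr /= altcoef_small // mul0r addr0.
case: r {v byparts} => [|r].
  by under eq_bigr do rewrite subrr mulr0; rewrite big1 // subr0.
rewrite elemsym0S oppr0 sub0r; congr (- _); apply: eq_bigr => j _.
by rewrite elemsymSS addrC addKr.
Qed.

Lemma altsumSS n r :
  altsum n.+1 r.+1 = altsum n r.+1 - q ^+ n.+1 / qnum q n.+1 * altsum n r.
Proof.
apply: (addIr (- altsum n r.+1)).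
rewrite -mulrN -(sum_altcoef_diff n r) [RHS]addrAC subrr add0r.
(* The sum defining [altsum n r.+1] is extended by a zero term to the range of
   [altsum n.+1 r.+1]. *)
have -> : altsum n r.+1 = \sum_(j < n.+1)
    altcoef n j.+1 * (recip_qnum j.+1 * elemsym recip_qnum j r).
  by rewrite big_ord_recr /= altcoef_small // mul0r addr0.
rewrite /= -sumrB mulr_sumr; apply: eq_bigr => j _.
by rewrite -mulrBl mulrA altcoef_step mulrA.
Qed.

Lemma sign_elemsym_altsum n m :
  (-1) ^+ m * elemsym (fun k => q ^+ k / qnum q k) n m = altsum n m.
Proof.
elim: n m => [|n IH] [|r]; rewrite ?mulr1 //.
  by rewrite elemsym0S mulr0 /= big_ord0.
by rewrite elemsymSS altsumSS -!IH exprS; ring.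
Qed.

Lemma Zgt_nseq1 n m :
  Zgt q n (nseq_tuple m 1%N) = elemsym (fun k => q ^+ k / qnum q k) n m.
Proof.
rewrite -(sum_desc _ m (leqnn n)); apply: eq_big => t.
  exact: strict_desc_desc.
by move=> _; rewrite big_tuple; apply: eq_bigr => j _; rewrite tnth_nseq expr1.
Qed.

Lemma Agt_nseq1 n m : Agt q n (nseq_tuple m 1%N) = altsum n m.
Proof.
have -> : Agt q n (nseq_tuple m 1%N) = \sum_(t : m.-tuple 'I_n.+1 | desc n t)
    altcoef n (first_idx t) * \prod_(i <- t) recip_qnum i.
  apply: eq_big => t; first exact: strict_desc_desc.
  move=> _; congr (_ * _); rewrite big_tuple; apply: eq_bigr => j _.
  (* The exponent [(s_j - 1) k_j] is zero. *)
  by rewrite tnth_nseq subrr mul0r expr0z mul1r expr1.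
case: m => [|r].
  rewrite (big_pred1 [tuple]) => [|t]; last by rewrite (tuple0 t) /desc /= eqxx.
  by rewrite /first_idx /= big_nil /altcoef qbinom0 !expr0 !mulr1.
rewrite sum_desc_split //=; apply: eq_bigr => j _.
by rewrite sum_desc // ltnW.
Qed.

End QBinomial.

Theorem theorem2 (R : realType) (q : R) (hq0 : 0 < q) (hq1 : q < 1)
    (m n : nat) :
  (-1) ^+ m * Zgt q n (nseq_tuple m 1%N) = Agt q n (nseq_tuple m 1%N).
Proof. by rewrite Zgt_nseq1 Agt_nseq1 sign_elemsym_altsum. Qed.
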